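(* Let $P$ and $Q$ be transition kernels on the same finite labelled state space $S=\{1,\dots,n\}$ with the same labelled action sets $A(s)$ and the same discount factor $\gamma\in(0,1)$. The following are equivalent. (i) $P\equiv_{\mathrm{sa}}Q$, i.e. $\operatorname{Opt}_{P,r}(s)=\operatorname{Opt}_{Q,r}(s)$ for every state--action reward $r$ and every $s\in S$. (ii) For every deterministic policy $\pi$, every state--action reward $r$, every state $s\in S$, and every action $a\in A(s)$, $A_{Q,r}^{\pi}(s,a)=A_{P,r}^{\pi}(s,a)$. (iii) There exists $L\in\mathcal G$ such that $Q=\Phi_L(P)$, i.e. $Q_{s,a}=\bigl(P_{s,a}+\tfrac1\gamma e_s^{\mathsf T}(L-I)\bigr)L^{-1}$ for every $s\in S$, $a\in A(s)$. The matrix $L$ in (iii) is unique. Moreover, when these conditions hold, this $L$ satisfies, for every deterministic policy $\pi$ and every state--action reward $r$, $$(I-\gamma Q^\pi)L=I-\gamma P^\pi,\qquad V_{Q,r}^{\pi}=L\,V_{P,r}^{\pi},\qquad V_{Q,r}^{*}=L\,V_{P,r}^{*}.$$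
   Context: $S=\{1,\dots,n\}$ is a finite set of states; each state $s$ has a finite nonempty action set $A(s)$; $\gamma\in(0,1)$ is fixed. A transition kernel $P$ assigns to each $s\in S$, $a\in A(s)$ a row vector $P_{s,a}=P(\cdot\mid s,a)\in\mathbb R^{1\times n}$ with nonnegative entries summing to $1$. Functions on $S$ are column vectors in $\mathbb R^n$; $\mathbf 1$ is the all-ones column vector and $e_s$ the $s$th standard basis column vector. A (stationary) deterministic policy $\pi$ chooses $\pi(s)\in A(s)$ for each $s$; $P^\pi$ is the $n\times n$ matrix whose $s$th row is $P_{s,\pi(s)}$. A state--action reward is a family of real numbers $r(s,a)$, $s\in S$, $a\in A(s)$; $r^\pi(s)=r(s,\pi(s))$. The policy value is $V_{P,r}^{\pi}=(I-\gamma P^\pi)^{-1}r^\pi$. The optimal value $V_{P,r}^*\in\mathbb R^n$ is the unique vector with $V_{P,r}^*(s)=\max_{a\in A(s)}\{r(s,a)+\gamma P_{s,a}V_{P,r}^*\}$ for all $s$, and $\operatorname{Opt}_{P,r}(s)=\arg\max_{a\in A(s)}\{r(s,a)+\gamma P_{s,a}V_{P,r}^*\}\subseteq A(s)$ is the set of optimal actions. The advantage is $A_{P,r}^{\pi}(s,a)=r(s,a)+\gamma P_{s,a}V_{P,r}^{\pi}-V_{P,r}^{\pi}(s)$. $\mathcal G=\{L\in \mathrm{GL}_n(\mathbb R):L\mathbf 1=\mathbf 1\}$, and for $L\in\mathcal G$, $\Phi_L(P)_{s,a}=\bigl(P_{s,a}+\tfrac1\gamma e_s^{\mathsf T}(L-I)\bigr)L^{-1}$.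 *)

(* Defs.v *)
From mathcomp Require Import all_boot all_order all_algebra.
From mathcomp Require Import boolp classical_sets reals.

Set Implicit Arguments.
Unset Strict Implicit.
Unset Printing Implicit Defensive.

Import Order.TTheory GRing.Theory Num.Theory.

Local Open Scope classical_set_scope.
Local Open Scope ring_scope.

(* State-action families with values in [X]; a reward has [X := R]. *)
Definition sa_family (n : nat) (A : 'I_n -> finType) (X : Type) :=
  forall s : 'I_n, A s -> X.

Definition policy (n : nat) (A : 'I_n -> finType) := forall s : 'I_n, A s.

Record kernel (R : realType) (n : nat) (A : 'I_n -> finType) := Kernel {
  kernel_row :> forall s : 'I_n, A s -> 'rV[R]_n;
  kernel_ge0 : forall (s : 'I_n) (a : A s) (t : 'I_n), 0 <= kernel_row a 0 t;
  kernel_sum1 : forall (s : 'I_n) (a : A s), \sum_t kernel_row a 0 t = 1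
}.

Section MDP.
Variables (R : realType) (n : nat) (A : 'I_n -> finType) (gamma : R).
Implicit Types (P Q : kernel R A) (r : sa_family A R) (pi : policy A).
Implicit Types (V : 'cV[R]_n) (L : 'M[R]_n).

Definition policy_mx P pi : 'M[R]_n := \matrix_(s < n) P s (pi s).

Definition policy_reward r pi : 'cV[R]_n := \col_(s < n) r s (pi s).

(* For a kernel and 0 < gamma < 1 the matrix 1 - gamma P^pi is invertible, so
   [invmx] is a genuine inverse here. *)
Definition policy_value P r pi : 'cV[R]_n :=
  invmx (1%:M - gamma *: policy_mx P pi) *m policy_reward r pi.

Definition lookahead P r V (s : 'I_n) (a : A s) : R :=
  r s a + gamma * (P s a *m V) 0 0.

Definition advantage P r pi (s : 'I_n) (a : A s) : R :=
  lookahead P r (policy_value P r pi) a - policy_value P r pi s 0.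

Definition is_max (E : set R) (m : R) : Prop := E m /\ ubound E m.

Definition bellman_optimal P r V : Prop :=
  forall s : 'I_n, is_max (range (@lookahead P r V s)) (V s 0).

(* The solution of the Bellman optimality equation: for 0 < gamma < 1 and
   nonempty action sets it exists and is unique, so the default 0 of [xget] is
   never used. *)
Definition optimal_value P r : 'cV[R]_n :=
  xget 0 [set V | bellman_optimal P r V].

Definition Opt P r (s : 'I_n) : set (A s) :=
  [set a | forall b : A s, lookahead P r (optimal_value P r) b
                           <= lookahead P r (optimal_value P r) a].

Definition sa_equiv P Q : Prop :=
  forall (r : sa_family A R) (s : 'I_n), @Opt P r s = @Opt Q r s.

Definition in_G L : Prop :=
  L \in unitmx /\ L *m const_mx 1 = const_mx 1 :> 'cV[R]_n.

(* The values of Phi_L(P) are bare row vectors: they need not be nonnegative. *)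
Definition Phi L P : sa_family A 'rV[R]_n := fun s a =>
  (P s a + gamma^-1 *: (delta_mx 0 s *m (L - 1%:M))) *m invmx L.

End MDP.

(* Main.v *)
Require Import Defs.
From mathcomp Require Import all_boot all_order all_algebra.
From mathcomp Require Import boolp classical_sets reals.

(** Write [d_P(s,a)] for the row vector [e_s - gamma P_(s,a)].  The relation
    [Q = Phi_L(P)] says exactly that [d_Q(s,a) L = d_P(s,a)] for all [s, a], and
    [lookahead P r V a - V s = r s a - d_P(s,a) V]; hence (iii) carries values,
    optimal values and advantages of [P] to those of [Q] by [V |-> L V].
    Conversely, fix a policy [pi] and put [L = (I - gamma Q^pi)^-1 (I - gamma P^pi)].
    Under (ii), rewards that depend on the state only make [V] arbitrary, which
    gives [d_Q L = d_P].  Under (i), use the reward [r s a = d_P(s,a) V]: for it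
    every action is [P]-optimal, with optimal value [V], so every action is
    [Q]-optimal, i.e. [d_Q(s,a) W = d_P(s,a) V] for all [s, a], where [W] is the
    [Q]-optimal value; necessarily [W = L V]. *)

Set Implicit Arguments.
Unset Strict Implicit.
Unset Printing Implicit Defensive.

Import Order.TTheory GRing.Theory Num.Theory.

Local Open Scope ring_scope.

Section DiscountedMDP.
Variables (R : realType) (n : nat) (A : 'I_n -> finType).
Variable gamma : R.
Hypotheses (gamma_gt0 : 0 < gamma) (gamma_lt1 : gamma < 1).
Implicit Types (P Q : kernel R A) (r : sa_family A R) (pi : policy A).
Implicit Types (V W : 'cV[R]_n) (L : 'M[R]_n).

(** * Discounted rows and invertibility of [I - gamma P^pi] *)

Definition discount_row P s (a : A s) : 'rV[R]_n :=
  delta_mx 0 s - gamma *: P s a.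

Definition discount_mx P pi : 'M[R]_n := 1%:M - gamma *: policy_mx P pi.

Lemma row_discount_mx P pi s :
  row s (discount_mx P pi) = discount_row P (pi s).
Proof.
rewrite /discount_mx /discount_row linearB linearZ /= row1; congr (_ - _ *: _).
by apply/rowP => t; rewrite !mxE.
Qed.

Lemma discount_mx_mulE P pi V s :
  (discount_mx P pi *m V) s 0 = (discount_row P (pi s) *m V) 0 0.
Proof. by rewrite -row_discount_mx -row_mul [RHS]mxE. Qed.

Lemma lookaheadE P r V s (a : A s) :
  lookahead gamma P r V a = V s 0 + (r s a - (discount_row P a *m V) 0 0).
Proof.
rewrite /lookahead /discount_row mulmxBl -scalemxAl -rowE !mxE.
by rewrite opprB addrCA [V s 0 + _]addrC subrK.
Qed.

Lemma kernel_row_one P s (a : A s) :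
  P s a *m const_mx 1 = const_mx 1 :> 'cV[R]_1.
Proof.
apply/colP => i; rewrite ord1 !mxE -[RHS](kernel_sum1 P a).
by apply: eq_bigr => t _; rewrite mxE mulr1.
Qed.

(* At a minimizer [s] of [V], [V s >= gamma (P^pi V) s >= gamma (V s)]. *)
Lemma discount_mx_monotone P pi V :
  (forall s, 0 <= (discount_mx P pi *m V) s 0) -> forall s, 0 <= V s 0.
Proof.
move=> NV_ge0 s0.
have [s _ s_min] := arg_minP (fun s => V s 0) (erefl : predT s0).
apply: le_trans (s_min s0 erefl); have := NV_ge0 s.
rewrite discount_mx_mulE mulmxBl -rowE -scalemxAl.
rewrite !mxE subr_ge0 => Vs.
have : gamma * V s 0 <= V s 0.
  apply: le_trans Vs; apply: ler_wpM2l; first exact: ltW.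
  rewrite -[leLHS]mul1r -(kernel_sum1 P (pi s)) mulr_suml.
  by apply: ler_sum => t _; rewrite ler_wpM2l ?kernel_ge0 ?s_min.
by rewrite -subr_ge0 -[X in X - _]mul1r -mulrBl pmulr_rge0 // subr_gt0.
Qed.

(** If [N x = 0], then [discount_mx_monotone] applies to both [x] and [- x], so [x = 0]. *)
Lemma discount_mx_unit P pi : discount_mx P pi \in unitmx.
Proof.
rewrite -unitmx_tr -row_free_unit -kermx_eq0.
apply/eqP/row_matrixP => i; rewrite row0.
set x := row i _.
have Nx0 : discount_mx P pi *m x^T = 0.
  apply: trmx_inj; rewrite trmx_mul trmxK trmx0.
  by rewrite /x -row_mul mulmx_ker row0.
apply: trmx_inj; rewrite trmx0; apply/colP => s; rewrite [RHS]mxE.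
apply/eqP; rewrite eq_le -oppr_ge0; apply/andP; split.
  suff: 0 <= (- x^T) s 0 by rewrite mxE.
  apply: (@discount_mx_monotone P pi) => t.
  by rewrite mulmxN Nx0 oppr0 mxE.
by apply: (@discount_mx_monotone P pi) => t; rewrite Nx0 mxE.
Qed.

Lemma discount_mx_value P r pi :
  discount_mx P pi *m policy_value gamma P r pi = policy_reward r pi.
Proof. by rewrite mulKVmx // discount_mx_unit. Qed.

Lemma discount_mx_one P pi :
  discount_mx P pi *m const_mx 1 = (1 - gamma) *: (const_mx 1 : 'cV[R]_n).
Proof.
apply/colP => s; rewrite discount_mx_mulE mulmxBl -rowE -scalemxAl.
by rewrite kernel_row_one !mxE !mulr1.
Qed.

(** * The Bellman equation in terms of discounted rows, and uniqueness of its solution *)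

Lemma bellman_optimalP P r V :
  bellman_optimal gamma P r V <->
  forall s, (exists a : A s, r s a = (discount_row P a *m V) 0 0) /\
            (forall a : A s, r s a <= (discount_row P a *m V) 0 0).
Proof.
split=> V_opt s; have [] := V_opt s.
- move=> [a _ Va] V_ub; split.
    exists a; move: Va; rewrite lookaheadE => /eqP.
    by rewrite -subr_eq0 addrC addKr subr_eq0 => /eqP.
  move=> b; have := V_ub _ (imageT _ b).
  by rewrite lookaheadE gerDl subr_le0.
- move=> [a ra] r_le; split.
    by exists a => //; rewrite lookaheadE ra subrr addr0.
  by move=> _ [b _ <-]; rewrite lookaheadE gerDl subr_le0.
Qed.

(** For a policy [pi] attaining the maxima for [V], the reward equals [(I - gamma P^pi) V] and is at
    most [(I - gamma P^pi) W]; monotonicity concludes. *)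
Lemma bellman_optimal_le P r V W :
  bellman_optimal gamma P r V -> bellman_optimal gamma P r W ->
  forall s, V s 0 <= W s 0.
Proof.
move=> /bellman_optimalP V_opt /bellman_optimalP W_opt s.
pose pi : policy A := fun t => projT1 (cid (V_opt t).1).
have pi_V t : r t (pi t) = (discount_row P (pi t) *m V) 0 0.
  exact: (projT2 (cid (V_opt t).1)).
suff : 0 <= (W - V) s 0 by rewrite !mxE subr_ge0.
apply: (@discount_mx_monotone P pi) => t.
rewrite discount_mx_mulE mulmxBr mxE [X in _ + X]mxE subr_ge0 -pi_V.
exact: (W_opt t).2.
Qed.

Lemma bellman_optimal_unique P r V W :
  bellman_optimal gamma P r V -> bellman_optimal gamma P r W -> V = W.
Proof.
move=> V_opt W_opt; apply/colP => s; apply/eqP.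
by rewrite eq_le (bellman_optimal_le V_opt) ?(bellman_optimal_le W_opt).
Qed.

Lemma optimal_value_eq P r V :
  bellman_optimal gamma P r V -> optimal_value gamma P r = V.
Proof.
move=> V_opt; apply: xget_unique => // W W_opt.
exact: bellman_optimal_unique W_opt V_opt.
Qed.

(** * Existence of the optimal value, and optimal actions as tight constraints *)

Section Existence.
Hypothesis A_nonempty : forall s : 'I_n, (0 < #|A s|)%N.

Definition default_policy : policy A :=
  fun s => enum_val (Ordinal (A_nonempty s)).

(* Policy iteration: a policy whose value has maximal sum cannot be strictly
   improved, so its value agrees with that of a greedy policy. *)
Lemma bellman_optimal_exists P r : exists V, bellman_optimal gamma P r V.
Proof.
(* Policies are taken as finite functions: they form a finite type, on which a maximizer exists. *)
pose val (f : {dffun forall s : 'I_n, A s}) := policy_value gamma P r f.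
have [f _ f_max] := arg_maxP (fun f => \sum_s val f s 0)
  (erefl : predT [ffun s => default_policy s]).
pose look s (a : A s) := lookahead gamma P r (val f) a.
have greedy s : exists a : A s, forall b, look s b <= look s a.
  have [a _ a_max] := arg_maxP (look s) (erefl : predT (default_policy s)).
  by exists a => b; apply: a_max.
pose g : {dffun forall s : 'I_n, A s} := [ffun s => projT1 (cid (greedy s))].
have g_max s (b : A s) : look s b <= look s (g s).
  by rewrite ffunE; apply: (projT2 (cid (greedy s))).
have look_f s : look s (f s) = val f s 0.
  by rewrite /look lookaheadE -discount_mx_mulE discount_mx_value
    [policy_reward _ _ _ _]mxE subrr addr0.
(* The one-step gain of the greedy [g] over [val f]: its nonnegativity gives [val f <= val g], and
   its vanishing once the values agree gives the Bellman equation. *)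
have gap s : (discount_mx P g *m (val g - val f)) s 0 = look s (g s) - val f s 0.
  rewrite mulmxBr discount_mx_value /look lookaheadE [RHS]addrC addKr.
  by rewrite mxE [X in _ + X]mxE discount_mx_mulE [policy_reward _ _ _ _]mxE.
have le_fg s : val f s 0 <= val g s 0.
  suff : 0 <= (val g - val f) s 0 by rewrite !mxE subr_ge0.
  apply: (@discount_mx_monotone P g) => t.
  by rewrite gap subr_ge0 -look_f.
have val_fg : val g = val f.
  apply/colP => s; apply/eqP; rewrite -subr_eq0.
  have : \sum_s (val g s 0 - val f s 0) == 0.
    rewrite eq_le sumr_ge0 ?andbT => [|t _]; last by rewrite subr_ge0.
    rewrite sumrB subr_le0; exact: (f_max g).
  rewrite psumr_eq0 => [/allP/(_ s)|t _]; last by rewrite subr_ge0.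
  by rewrite mem_index_enum; apply.
have look_g s : look s (g s) = val f s 0.
  by apply/eqP; rewrite -subr_eq0 -gap val_fg subrr mulmx0 mxE.
exists (val f) => s; split; first by exists (g s).
by move=> _ [b _ <-]; rewrite -look_g; apply: g_max.
Qed.

Lemma optimal_valueP P r : bellman_optimal gamma P r (optimal_value gamma P r).
Proof. exact: (xgetPex 0 (bellman_optimal_exists P r)). Qed.

Lemma OptE P r s (a : A s) :
  Opt gamma P r a <->
  r s a = (discount_row P a *m optimal_value gamma P r) 0 0.
Proof.
have [[b rb] r_le] := (bellman_optimalP _ _ _).1 (optimal_valueP P r) s.
split=> [/(_ b)|ra c]; rewrite !lookaheadE lerD2l.
  by rewrite rb subrr subr_ge0 => ?; apply/eqP; rewrite eq_le r_le.
by rewrite ra subrr subr_le0.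
Qed.

End Existence.

(** * Condition (iii) as intertwining, and its consequences *)

Definition intertwines L P Q :=
  forall s (a : A s), discount_row Q a *m L = discount_row P a.

(** By [key], [gamma] times the unnormalized row in [Phi] is [e_s L - d_P(s,a)]; multiplying on the
    right by [L] or its inverse passes between the two forms. *)
Lemma PhiE L P Q : L \in unitmx ->
  (forall s (a : A s), Q s a = Phi gamma L P a) <-> intertwines L P Q.
Proof.
move=> L_unit; have gamma_neq0 : gamma != 0 by rewrite gt_eqF.
have key s (a : A s) : gamma *: (P s a + gamma^-1 *: (delta_mx 0 s *m (L - 1%:M)))
    = delta_mx 0 s *m L - discount_row P a.
  rewrite scalerDr scalerA divff // scale1r mulmxBr mulmx1 /discount_row opprB.
  by rewrite addrCA.
split=> QL s a.
  rewrite [discount_row Q a]/discount_row QL /Phi scalemxAl key mulmxBl.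
  by rewrite mulmxKV // subKr.
apply: (scalerI gamma_neq0); rewrite /Phi scalemxAl key -QL -mulmxBl.
by rewrite mulmxK // /discount_row subKr.
Qed.

Lemma intertwines_mx L P Q pi :
  intertwines L P Q -> discount_mx Q pi *m L = discount_mx P pi.
Proof.
by move=> QL; apply/row_matrixP => s; rewrite row_mul !row_discount_mx QL.
Qed.

Lemma intertwines_value L P Q r pi : intertwines L P Q ->
  policy_value gamma Q r pi = L *m policy_value gamma P r pi.
Proof.
move=> QL; apply: (can_inj (mulKmx (discount_mx_unit Q pi))).
by rewrite [RHS]mulmxA (intertwines_mx pi QL) !discount_mx_value.
Qed.

Lemma intertwines_bellman L P Q r V : intertwines L P Q ->
  bellman_optimal gamma P r V -> bellman_optimal gamma Q r (L *m V).
Proof.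
move=> QL /bellman_optimalP V_opt; apply/bellman_optimalP => s.
have [[a ra] r_le] := V_opt s; split; first by exists a; rewrite mulmxA QL.
by move=> b; rewrite mulmxA QL.
Qed.

(** The only possible intertwining matrix, whichever [pi] is used; hence the uniqueness of [L]. *)
Definition transfer_mx P Q pi : 'M[R]_n :=
  invmx (discount_mx Q pi) *m discount_mx P pi.

Lemma transfer_mx_in_G P Q pi : in_G (transfer_mx P Q pi).
Proof.
split; first by rewrite unitmx_mul unitmx_inv !discount_mx_unit.
(* Both discount matrices send the all-ones vector to [1 - gamma] times itself. *)
rewrite -mulmxA discount_mx_one -(discount_mx_one Q pi).
by rewrite mulKmx ?discount_mx_unit.
Qed.

Lemma intertwines_transfer L P Q pi :
  intertwines L P Q -> L = transfer_mx P Q pi.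
Proof.
by move=> QL; rewrite /transfer_mx -(intertwines_mx pi QL) mulKmx ?discount_mx_unit.
Qed.

(** * Recovering the intertwining from (ii) and from (i) *)

Lemma advantageE P r pi s (a : A s) :
  advantage gamma P r pi a
    = r s a - (discount_row P a *m policy_value gamma P r pi) 0 0.
Proof. by rewrite /advantage lookaheadE addrC addKr. Qed.

Lemma advantage_transfer P Q pi :
  (forall r s (a : A s), advantage gamma Q r pi a = advantage gamma P r pi a) ->
  intertwines (transfer_mx P Q pi) P Q.
Proof.
move=> advQP s a; apply/rowP => t.
(* Testing on the basis vector [V] compares the two rows at column [t]; the reward below has [V] as
   its [pi]-value under [P]. *)
pose V : 'cV[R]_n := delta_mx t 0.
pose r : sa_family A R := fun u _ => (discount_mx P pi *m V) u 0.
have reward_r : policy_reward r pi = discount_mx P pi *m V.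
  by apply/colP => u; rewrite mxE.
have := advQP r s a; rewrite !advantageE => /addrI/oppr_inj.
rewrite /policy_value reward_r -/(discount_mx P pi) -/(discount_mx Q pi).
rewrite mulKmx ?discount_mx_unit // [invmx _ *m _]mulmxA mulmxA.
by rewrite -/(transfer_mx P Q pi) -!colE !mxE.
Qed.

Lemma sa_equiv_transfer (A_nonempty : forall s, (0 < #|A s|)%N) P Q pi :
  sa_equiv gamma P Q -> intertwines (transfer_mx P Q pi) P Q.
Proof.
move=> eqPQ s a; apply/rowP => t.
pose V : 'cV[R]_n := delta_mx t 0.
pose r : sa_family A R := fun u b => (discount_row P b *m V) 0 0.
have V_opt : optimal_value gamma P r = V.
  apply/optimal_value_eq/bellman_optimalP => u.
  by split=> //; exists (default_policy A_nonempty u).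
pose W := optimal_value gamma Q r.
have QW u (b : A u) : (discount_row Q b *m W) 0 0 = (discount_row P b *m V) 0 0.
  by symmetry; apply/OptE => //; rewrite -eqPQ; apply/OptE => //; rewrite V_opt.
(* The equalities [QW] at the actions of [pi] alone determine [W]; those at all other actions then
   yield the intertwining. *)
have W_V : W = transfer_mx P Q pi *m V.
  apply: (can_inj (mulKmx (discount_mx_unit Q pi))).
  rewrite /transfer_mx !mulmxA mulmxV ?discount_mx_unit // mul1mx.
  by apply/colP => u; rewrite !discount_mx_mulE.
by have := QW s a; rewrite W_V mulmxA -!colE !mxE.
Qed.

End DiscountedMDP.

Theorem theorem3p4 (R : realType) (n : nat) (A : 'I_n -> finType)
    (A_nonempty : forall s : 'I_n, (0 < #|A s|)%N)
    (gamma : R) (gamma_gt0 : 0 < gamma) (gamma_lt1 : gamma < 1)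
    (P Q : kernel R A) :
  let cond_i := sa_equiv gamma P Q in
  let cond_ii := forall (pi : policy A) (r : sa_family A R) (s : 'I_n)
    (a : A s), advantage gamma Q r pi a = advantage gamma P r pi a in
  let transforms (L : 'M[R]_n) := in_G L /\
    forall (s : 'I_n) (a : A s), Q s a = Phi gamma L P a in
  let cond_iii := exists L : 'M[R]_n, transforms L in
  [/\ cond_i <-> cond_ii,
      cond_ii <-> cond_iii,
      forall L L' : 'M[R]_n, transforms L -> transforms L' -> L = L'
    & forall L : 'M[R]_n, transforms L ->
      forall (pi : policy A) (r : sa_family A R),
      [/\ (1%:M - gamma *: policy_mx Q pi) *m L
            = 1%:M - gamma *: policy_mx P pi,
          policy_value gamma Q r pi = L *m policy_value gamma P r pi
        & optimal_value gamma Q r = L *m optimal_value gamma P r]].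
Proof.
move=> cond_i cond_ii transforms cond_iii.
have transformsE L : transforms L <-> in_G L /\ intertwines gamma L P Q.
  by split=> -[L_G QL]; split=> //; apply/(PhiE gamma_gt0 _ _ L_G.1).
(* An arbitrary reference policy, fixed to name the candidate [L0]. *)
pose pi0 := default_policy A_nonempty.
pose L0 := transfer_mx gamma P Q pi0.
have L0P : intertwines gamma L0 P Q -> cond_iii.
  by move=> QL0; exists L0; apply/transformsE; split=> //; apply: transfer_mx_in_G.
have opt_value L r : intertwines gamma L P Q ->
    optimal_value gamma Q r = L *m optimal_value gamma P r.
  move=> QL; apply: optimal_value_eq => //.
  by apply: intertwines_bellman => //; apply: optimal_valueP.
have iii_i : cond_iii -> cond_i.
  move=> [L /transformsE[_ QL]] r s; apply/predeqP => a.
  by rewrite !OptE // (opt_value L) // mulmxA QL.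
have ii_iii : cond_ii <-> cond_iii.
  split=> [advQP|[L /transformsE[_ QL]] pi r s a].
    by apply/L0P/advantage_transfer.
  by rewrite !advantageE (intertwines_value _ _ _ _ QL) // mulmxA QL.
split=> //.
- split=> [eqPQ|/ii_iii/iii_i//].
  by apply/ii_iii/L0P/sa_equiv_transfer.
- move=> L L' /transformsE[_ QL] /transformsE[_ QL'].
  rewrite (intertwines_transfer gamma_gt0 gamma_lt1 pi0 QL).
  by rewrite (intertwines_transfer gamma_gt0 gamma_lt1 pi0 QL').
- move=> L /transformsE[_ QL] pi r; split; last exact: opt_value.
    exact: intertwines_mx.
  exact: intertwines_value.
Qed.
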